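(* Let $(V,\Upsilon(z),c,\rho)$ be a graded vertex operator coalgebra and $g\in\mathrm{Aut}\,V$ an automorphism of finite order $T$ with $\dim C_g(V)<\infty$. Let $(\mathcal M^1,\Upsilon_{\mathcal M^1}(z))$ and $(\mathcal M^2,\Upsilon_{\mathcal M^2}(z))$ be admissible $g$-twisted $V$-comodules. If $\psi:\mathcal M^1\to\mathcal M^2$ is a $g$-twisted $V$-comodule homomorphism, then $\psi|_{M^1_0}:M^1_0\to M^2_0$ is a $C_g(V)$-comodule homomorphism. Thus $\Omega_g(\mathcal M)=M_0$ (with $\Omega_g(\psi)=\psi|_{M_0^1}$) defines a functor $\Omega_g$ from the category of admissible $g$-twisted $V$-comodules to the category of $C_g(V)$-comodules.
   Context: All vector spaces are over $\mathbb C$; $\mathbb N=\{0,1,2,\dots\}$; $\tau(v\otimes w)=w\otimes v$; $(z_1+z_2)^n$ is expanded in nonnegative powers of $z_2$; $\delta(x)=\sum_{n\in\mathbb Z}x^n$; $\mathrm{Res}_z$ is the coefficient of $z^{-1}$. Graded vertex operator coalgebra $(V,\Upsilon(z),c,\rho)$: $V=\bigoplus_{s\in\mathbb Z}V_s$, $\dim V_s<\infty$, $V_s=0$ for $s\ll0$; linear maps $c,\rho:V\to\mathbb C$ and $\Upsilon(z):V\to(V\otimes V)[[z,z^{-1}]]$, $\Upsilon(z)v=\sum_{k\in\mathbb Z}\Delta_k(v)z^{-k-1}$, with: (1) $\Delta_k(v)=0$ for $k\ll0$ and $\Delta_k(V_s)\subseteq(V\otimes V)_{s+k+1}$; (2)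 $(c\otimes\mathrm{Id})\Upsilon(z)v=v$, $(\mathrm{Id}\otimes c)\Upsilon(z)v\in V[[z]]$ with constant term $v$; (3) Jacobi identity $z_0^{-1}\delta(\frac{z_1-z_2}{z_0})(\mathrm{Id}\otimes\Upsilon(z_2))\Upsilon(z_1)-z_0^{-1}\delta(\frac{z_2-z_1}{-z_0})(\tau\otimes\mathrm{Id})(\mathrm{Id}\otimes\Upsilon(z_1))\Upsilon(z_2)=z_1^{-1}\delta(\frac{z_2+z_0}{z_1})(\Upsilon(z_0)\otimes\mathrm{Id})\Upsilon(z_2)$; (4) writing $(\rho\otimes\mathrm{Id})\Upsilon(z)=\sum_kL(k)z^{k-2}$, the operators $L(k)\in\mathrm{End}(V)$ satisfy $[L(k),L(j)]=(k-j)L(k+j)+\frac{k^3-k}{12}\delta_{k+j,0}d$ for a constant $d$, $V_s$ is the $s$-eigenspace of $L(0)$, and $(L(1)\otimes\mathrm{Id})\Upsilon(z)=\frac{d}{dz}\Upsilon(z)$. Automorphisms: linear bijections $g$ of $V$ with $c\circ g=c$, $\rho\circ g=\rho$, $\Upsilon(z)g=(g\otimes g)\Upsilon(z)$. For $g$ of order $T$: $V^{(r)}=\{v: gv=e^{2\pi ir/T}v\}$, $0\le r\le T-1$; $\frac{\ln g}{2\pi i}$ acts on $V^{(r)}$ as $\frac rT$; $z^\phi v=z^\lambda v$ if $\phi v=\lambda v$; $\delta_0:V\to V$ is the projection onto $V^{(0)}$ along $\bigoplus_{r\ne0}V^{(r)}$. Weak $g$-twisted $V$-comodule: a vector space $\mathcal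 M$ with a linear map $\Upsilon_{\mathcal M}(z)m=\sum_{k\in\mathbb Z}(z^{-\frac{\ln g}{2\pi i}}\otimes\mathrm{Id})\Delta_{\mathcal M,k}(m)z^{-k-1}$, $\Delta_{\mathcal M,k}:\mathcal M\to V\otimes\mathcal M$, with: (i) $\Delta_{\mathcal M,k}(m)=0$ for $k\ll0$, $(c\otimes\mathrm{Id})\Upsilon_{\mathcal M}(z)=\mathrm{Id}$; (ii) $z_0^{-1}\delta(\frac{z_1-z_2}{z_0})(\mathrm{Id}\otimes\Upsilon_{\mathcal M}(z_2))\Upsilon_{\mathcal M}(z_1)-z_0^{-1}\delta(\frac{z_2-z_1}{-z_0})(\tau\otimes\mathrm{Id})(\mathrm{Id}\otimes\Upsilon_{\mathcal M}(z_1))\Upsilon_{\mathcal M}(z_2)=z_2^{-1}\delta(\frac{z_1-z_0}{z_2})((\frac{z_1-z_0}{z_2})^{-\frac{\ln g}{2\pi i}}\otimes\mathrm{Id}\otimes\mathrm{Id})(\Upsilon(z_0)\otimes\mathrm{Id})\Upsilon_{\mathcal M}(z_2)$; (iii) writing $(\rho\otimes\mathrm{Id})\Upsilon_{\mathcal M}(z)=\sum_kL(k)z^{k-2}$, $L(k)\in\mathrm{End}(\mathcal M)$ satisfy the same Virasoro relations; (iv) $(L(1)\otimes\mathrm{Id})\Upsilon_{\mathcal M}(z)=\frac d{dz}\Upsilon_{\mathcal M}(z)=\Upsilon_{\mathcal M}(z)L(1)-(\mathrm{Id}\otimes L(1))\Upsilon_{\mathcal M}(z)$. It is admissible if $\mathcal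 M=\bigoplus_{t\in\frac1T\mathbb N}M_t$ with $\Delta_{\mathcal M,k}(M_t)\subseteq\bigoplus_{r=0}^{T-1}(V^{(r)}\otimes\mathcal M)_{t+k+1+\frac rT}$. A homomorphism of admissible $g$-twisted comodules is a grading-preserving linear map $\psi$ with $(\mathrm{Id}\otimes\psi)\Upsilon_{\mathcal M^1}(z)=\Upsilon_{\mathcal M^2}(z)\psi$. $C_g(V)=\{v\in V:\ \mathrm{Res}_z\big(\tfrac{(1+z)^{L(0)-1+\delta_0+\frac{\ln g}{2\pi i}}}{z^{1+\delta_0}}\otimes\mathrm{Id}\big)\Upsilon(z)v=0\}$, where the operator on the first tensor factor acts on $V_s\cap V^{(r)}$ as $(1+z)^{s}z^{-2}$ if $r=0$ and $(1+z)^{s-1+r/T}z^{-1}$ if $r\ne0$; residues are a priori elements of $\prod_n(V\otimes V)_n$. For $\dim C_g(V)<\infty$ it is a coassociative coalgebra with counit $c|_{C_g(V)}$ and coproduct $\Delta_g(v)=\mathrm{Res}_z\big(\tfrac{\delta_0\circ(1+z)^{L(0)}}{z}\otimes\mathrm{Id}\big)\Upsilon(z)v$. For an admissible $g$-twisted $V$-comodule $\mathcal M$, $M_0$ is a left $C_g(V)$-comodule via $\Delta_{M_0}(m)=\mathrm{Res}_z(z^{L(0)-1}\otimes\mathrm{Id})\Upsilon_{\mathcal M}(z)m$. A $C$-comodule homomorphism $\psi$ satisfies $(\mathrm{Id}\otimes\psi)\Delta_{M^1}=\Delta_{M^2}\psi$.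
   Formalization: That C_g(V) is a coalgebra and each M_0 a C_g(V)-comodule is taken as a hypothesis; the latter fails in general for C_g(V) inside V (e.g. when L(0) is nonzero on M_0), while the identity (Id⊗ψ)Δ=Δψ on M_0 is proved without it. *)

(* Defs.v *)
From HB Require Import structures.
From mathcomp Require Import all_boot all_order all_algebra.
From mathcomp Require Import generic_quotient.
From mathcomp Require Import complex finmap.
From mathcomp Require Import boolp classical_sets functions cardinality fsbigop.
From mathcomp Require Import reals trigo.
From mathcomp Require Import ring.

Set Implicit Arguments.
Unset Strict Implicit.
Unset Printing Implicit Defensive.

Import Order.TTheory GRing.Theory Num.Theory.
Local Open Scope ring_scope.

(* The congruence on formal sums of pairs (the free commutative monoid on V * W,
   sums being lists) whose quotient is the tensor product; 0 and opposites come
   from the zero rule and from scaling by -1. *)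
Section Tensor.
Local Open Scope quotient_scope.
Context {K : fieldType}.
Implicit Types V W : lmodType K.

Inductive tens_eq V W : seq (V * W) -> seq (V * W) -> Prop :=
| tens_refl s : tens_eq s s
| tens_sym s t : tens_eq s t -> tens_eq t s
| tens_trans s t u : tens_eq s t -> tens_eq t u -> tens_eq s u
| tens_cat s s' t t' :
    tens_eq s s' -> tens_eq t t' -> tens_eq (s ++ t) (s' ++ t')
| tens_comm s t : tens_eq (s ++ t) (t ++ s)
| tens_addl v v' w : tens_eq [:: (v + v', w)] [:: (v, w); (v', w)]
| tens_addr v w w' : tens_eq [:: (v, w + w')] [:: (v, w); (v, w')]
| tens_scale a v w : tens_eq [:: (a *: v, w)] [:: (v, a *: w)]
| tens_zero w : tens_eq [:: (0, w)] [::].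

Definition tens_rel V W : rel (seq (V * W)) := fun s t => `[< tens_eq s t >].

Lemma tens_relP V W (s t : seq (V * W)) : reflect (tens_eq s t) (tens_rel s t).
Proof. exact: asboolP. Qed.

Lemma tens_rel_refl V W : reflexive (@tens_rel V W).
Proof. by move=> s; apply/tens_relP; exact: tens_refl. Qed.
Lemma tens_rel_sym V W : symmetric (@tens_rel V W).
Proof.
by move=> s t; apply/idP/idP => /tens_relP /tens_sym h; apply/tens_relP.
Qed.
Lemma tens_rel_trans V W : transitive (@tens_rel V W).
Proof.
by move=> t s u /tens_relP h1 /tens_relP h2; apply/tens_relP; exact: tens_trans h2.
Qed.

Canonical tens_equiv V W :=
  EquivRel (@tens_rel V W) (@tens_rel_refl V W) (@tens_rel_sym V W)
    (@tens_rel_trans V W).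

Definition tensor V W := {eq_quot (@tens_rel V W)}.
HB.instance Definition _ V W := Choice.on (tensor V W).
HB.instance Definition _ V W := EqQuotient.on (tensor V W).

Section Lmod.
Variables V W : lmodType K.
Local Notation T := (tensor V W).
Implicit Types (s t : seq (V * W)).

Lemma tens_piE s t : \pi_T s = \pi_T t <-> tens_eq s t.
Proof. by split=> [/eqmodP/tens_relP|h]; last by apply/eqmodP/tens_relP. Qed.

Definition tscal (a : K) s := [seq (a *: p.1, p.2) | p <- s].

Lemma tscal_eq a s t : tens_eq s t -> tens_eq (tscal a s) (tscal a t).
Proof.
elim=> {s t} [s|s t _|s t u _ + _|s s' t t' _ + _|s t|v v' w|v w w'|b v w|w].
- exact: tens_refl.
- by move=> h; exact: tens_sym.
- by move=> h1 h2; exact: tens_trans h2.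
- by move=> h1 h2; rewrite /tscal !map_cat; exact: tens_cat.
- by rewrite /tscal !map_cat; exact: tens_comm.
- by rewrite /tscal /= scalerDr; exact: tens_addl.
- exact: tens_addr.
- by rewrite /tscal /= scalerA mulrC -scalerA; exact: tens_scale.
- by rewrite /tscal /= scaler0; exact: tens_zero.
Qed.

Definition tzero : T := \pi_T [::].
Definition tadd (x y : T) : T := \pi_T (repr x ++ repr y).
Definition tscale a (x : T) : T := \pi_T (tscal a (repr x)).
Definition topp := tscale (-1).

Lemma tens_repr s : tens_eq (repr (\pi_T s)) s.
Proof. by apply/tens_piE; rewrite reprK. Qed.

Lemma taddE s t : tadd (\pi_T s) (\pi_T t) = \pi_T (s ++ t).
Proof. by apply/tens_piE; apply: tens_cat; exact: tens_repr. Qed.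
Lemma tscaleE a s : tscale a (\pi_T s) = \pi_T (tscal a s).
Proof. by apply/tens_piE; apply: tscal_eq; exact: tens_repr. Qed.

Lemma taddA : associative tadd.
Proof.
move=> x y z; rewrite -[x]reprK -[y]reprK -[z]reprK.
by rewrite (taddE (repr y)) (taddE (repr x) (repr y)) !taddE catA.
Qed.
Lemma taddC : commutative tadd.
Proof.
by move=> x y; rewrite -[x]reprK -[y]reprK !taddE; apply/tens_piE; exact: tens_comm.
Qed.
Lemma tadd0 : left_id tzero tadd.
Proof. by move=> x; rewrite -[x]reprK !taddE. Qed.

Lemma tscalDl a b s : tens_eq (tscal (a + b) s) (tscal a s ++ tscal b s).
Proof.
elim: s => [|[v w] s IH]; first exact: tens_refl.
apply: (@tens_trans _ _ _ ([:: (a *: v, w); (b *: v, w)]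
                           ++ (tscal a s ++ tscal b s))).
  rewrite /tscal /= scalerDl -/(tscal _ s).
  by apply: (@tens_cat _ _ [:: _] [:: _; _]) => //; exact: tens_addl.
rewrite -[X in tens_eq X]/([:: (a *: v, w)] ++ ([:: (b *: v, w)] ++ (tscal a s ++ tscal b s))).
rewrite -[X in tens_eq _ X]/([:: (a *: v, w)] ++ (tscal a s ++ ([:: (b *: v, w)] ++ tscal b s))).
apply: tens_cat; first exact: tens_refl.
rewrite !catA; apply: tens_cat; last exact: tens_refl.
exact: tens_comm.
Qed.

Lemma tscal0 s : tens_eq (tscal 0 s) [::].
Proof.
elim: s => [|[v w] s IH]; first exact: tens_refl.
rewrite /tscal /= scale0r -/(tscal 0 s).
by apply: (@tens_cat _ _ [:: _] [::] _ [::]) => //; exact: tens_zero.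
Qed.

Lemma tscal1 s : tscal 1 s = s.
Proof. by rewrite /tscal -[RHS]map_id; apply: eq_map => -[v w] /=; rewrite scale1r. Qed.

Lemma taddN : left_inverse tzero topp tadd.
Proof.
move=> x; rewrite -[x]reprK /topp tscaleE taddE -{2}[repr x]tscal1.
apply/tens_piE; apply: (tens_trans _ (tscal0 (repr x))).
by rewrite -(addNr 1); apply/tens_sym/tscalDl.
Qed.

HB.instance Definition _ := GRing.isZmodule.Build T taddA taddC tadd0 taddN.

Lemma tscaleA a b x : tscale a (tscale b x) = tscale (a * b) x.
Proof.
rewrite -[x]reprK (tscaleE b (repr x)) !tscaleE /tscal -map_comp; congr (\pi_T _).
by apply: eq_map => -[v w] /=; rewrite scalerA.
Qed.
Lemma tscale1 : left_id 1 tscale.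
Proof. by move=> x; rewrite -[x]reprK tscaleE tscal1. Qed.
Lemma tscaleDr : right_distributive tscale +%R.
Proof.
move=> a x y; rewrite -[x]reprK -[y]reprK /GRing.add /=.
rewrite (taddE (repr x) (repr y)) (tscaleE a (repr x)) (tscaleE a (repr y)).
by rewrite tscaleE taddE /tscal map_cat.
Qed.
Lemma tscaleDl x : {morph tscale^~ x : a b / a + b}.
Proof.
move=> a b; rewrite -[x]reprK [in RHS]/GRing.add /= !(tscaleE _ (repr x)) taddE.
by apply/tens_piE; exact: tscalDl.
Qed.

HB.instance Definition _ :=
  GRing.Zmodule_isLmodule.Build K T tscaleA tscale1 tscaleDr tscaleDl.

End Lmod.

Definition tens V W (v : V) (w : W) : tensor V W := \pi_(tensor V W) [:: (v, w)].

(* Linear map induced by a bilinear f; no meaning is attached to tlift f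
   otherwise. *)
Definition tlift V W (U : lmodType K) (f : V -> W -> U) (x : tensor V W) : U :=
  \sum_(p <- repr x) f p.1 p.2.

Definition bilin V W (U : lmodType K) (f : V -> W -> U) :=
  (forall w, linear (f^~ w)) /\ (forall v, linear (f v)).

End Tensor.

Arguments tensor {K} (V W)%_type_scope.
Notation "V ⊗ W" := (tensor V W) (at level 40, left associativity) : type_scope.
Notation "v ⊗ w" := (tens v w) (at level 40, left associativity) : ring_scope.

Section TensorTheory.
Local Open Scope quotient_scope.
Context {K : fieldType}.
Implicit Types U V W : lmodType K.

Lemma tens_bilin V W : bilin (@tens K V W).
Proof.
split=> [w a v v'|v a w w']; rewrite /tens.
- apply: (etrans (y := \pi_(V ⊗ W)%type ([:: (a *: v, w); (v', w)]))).
    by apply/tens_piE; exact: tens_addl.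
  rewrite -[LHS](taddE [:: _] [:: _]); congr (tadd _ _).
  exact: esym (tscaleE a [:: (v, w)]).
- apply: (etrans (y := \pi_(V ⊗ W)%type ([:: (v, a *: w); (v, w')]))).
    by apply/tens_piE; exact: tens_addr.
  rewrite -[LHS](taddE [:: _] [:: _]); congr (tadd _ _).
  rewrite -[RHS]/(tscale a _) (tscaleE a [:: (v, w)]).
  by apply/tens_piE; apply: tens_sym; exact: tens_scale.
Qed.

HB.instance Definition _ V W (v : V) :=
  GRing.isLinear.Build K W (V ⊗ W)%type *:%R (tens v) ((tens_bilin V W).2 v).

Lemma tensDl V W (v v' : V) (w : W) : (v + v') ⊗ w = v ⊗ w + v' ⊗ w.
Proof. by have := (tens_bilin V W).1 w 1 v v'; rewrite !scale1r. Qed.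
Lemma tens0l V W (w : W) : (0 : V) ⊗ w = 0.
Proof.
by have := tensDl (0 : V) 0 w; rewrite addr0 => /eqP; rewrite -subr_eq subrr => /eqP.
Qed.
Lemma tensZl V W a (v : V) (w : W) : (a *: v) ⊗ w = a *: (v ⊗ w).
Proof. by have := (tens_bilin V W).1 w a v 0; rewrite tens0l !addr0. Qed.

Lemma tlift_pi V W U (f : V -> W -> U) s : bilin f ->
  tlift f (\pi_(V ⊗ W)%type s) = \sum_(p <- s) f p.1 p.2.
Proof.
case=> fl fr; rewrite /tlift; have := tens_repr s.
set t := repr _ => h; elim: h => {s t} //.
- by move=> s t u _ -> _ ->.
- by move=> s s' t t' _ + _; rewrite !big_cat /= => -> ->.
- by move=> s t; rewrite !big_cat /= addrC.
- move=> v v' w; rewrite big_cons big_nil big_cons big_seq1 /= addr0.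
  by have := fl w 1 v v'; rewrite !scale1r.
- move=> v w w'; rewrite big_cons big_nil big_cons big_seq1 /= addr0.
  by have := fr v 1 w w'; rewrite !scale1r.
- move=> a v w; rewrite !big_seq1 /=.
  have f0l : f 0 w = 0.
    by have := fl w 1 0 0; rewrite !scale1r addr0 => /eqP; rewrite -subr_eq subrr => /eqP.
  have f0r : f v 0 = 0.
    by have := fr v 1 0 0; rewrite !scale1r addr0 => /eqP; rewrite -subr_eq subrr => /eqP.
  have := fl w a v 0; have := fr v a w 0.
  by rewrite f0l f0r !addr0 => -> ->.
- move=> w; rewrite big_seq1 big_nil /=.
  by have := fl w 1 0 0; rewrite !scale1r addr0 => /eqP; rewrite -subr_eq subrr => /eqP.
Qed.

Lemma tlift_tens V W U (f : V -> W -> U) v w : bilin f -> tlift f (v ⊗ w) = f v w.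
Proof. by move=> bf; rewrite tlift_pi // big_seq1. Qed.

Lemma tlift_linear V W U (f : V -> W -> U) : bilin f -> linear (tlift f).
Proof.
move=> bf a x y; rewrite -[x]reprK -[y]reprK.
rewrite -[a *: _]/(tscale a _) -[_ + _ as X in tlift f X]/(tadd _ _).
rewrite tscaleE taddE !tlift_pi // big_cat /= scaler_sumr; congr (_ + _).
rewrite big_map; apply: eq_bigr => -[v w] _ /=.
have f0 : f 0 w = 0.
  by have := bf.1 w 1 0 0; rewrite !scale1r addr0 => /eqP; rewrite -subr_eq subrr => /eqP.
by have := bf.1 w a v 0; rewrite f0 !addr0.
Qed.

Lemma tensor_ind V W (P : V ⊗ W -> Prop) :
  P 0 -> (forall v w x, P x -> P (v ⊗ w + x)) -> forall x, P x.
Proof.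
move=> P0 PS x; rewrite -[x]reprK; elim: (repr x) => [|[v w] s IH]; first exact: P0.
by rewrite -[X in P X](taddE [:: _]); exact: PS.
Qed.

Lemma tens_ext V W U (f h : {linear (V ⊗ W)%type -> U}) :
  (forall v w, f (v ⊗ w) = h (v ⊗ w)) -> f =1 h.
Proof.
move=> fh; elim/tensor_ind => [|v w x IH]; first by rewrite !linear0.
by rewrite !linearD fh IH.
Qed.

Definition tmap V W V' W' (f : V -> V') (h : W -> W') : V ⊗ W -> V' ⊗ W' :=
  tlift (fun v w => f v ⊗ h w).

Section Maps.
Variables V W V' W' : lmodType K.

Lemma tmap_bilin (f : {linear V -> V'}) (h : {linear W -> W'}) :
  bilin (fun v w => f v ⊗ h w).
Proof.
by split=> [w a v v'|v a w w']; rewrite !linearP ?tensDl ?tensZl.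
Qed.

HB.instance Definition _ (f : {linear V -> V'}) (h : {linear W -> W'}) :=
  GRing.isLinear.Build K (V ⊗ W)%type (V' ⊗ W')%type *:%R (tmap f h)
    (tlift_linear (tmap_bilin f h)).

Lemma tmapE (f : {linear V -> V'}) (h : {linear W -> W'}) v w :
  tmap f h (v ⊗ w) = f v ⊗ h w.
Proof. exact: tlift_tens (tmap_bilin f h). Qed.

(* phi (x) Id and Id (x) phi for a linear form phi, through the identifications
   K (x) W = W and V (x) K = V. *)
Definition tforml (phi : V -> K) : V ⊗ W -> W := tlift (fun v w => phi v *: w).
Definition tformr (phi : W -> K) : V ⊗ W -> V := tlift (fun v w => phi w *: v).

Lemma tforml_bilin (phi : {scalar V}) : bilin (fun v (w : W) => phi v *: w).
Proof.
split=> [w a v v'|v a w w'].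
  by rewrite linearP scalerDl scalerA.
by rewrite scalerDr !scalerA mulrC.
Qed.
Lemma tformr_bilin (phi : {scalar W}) : bilin (fun (v : V) w => phi w *: v).
Proof.
split=> [w a v v'|v a w w'].
  by rewrite scalerDr !scalerA mulrC.
by rewrite linearP scalerDl scalerA.
Qed.

HB.instance Definition _ (phi : {scalar V}) :=
  GRing.isLinear.Build K (V ⊗ W)%type W *:%R (tforml phi)
    (tlift_linear (tforml_bilin phi)).
HB.instance Definition _ (phi : {scalar W}) :=
  GRing.isLinear.Build K (V ⊗ W)%type V *:%R (tformr phi)
    (tlift_linear (tformr_bilin phi)).

Definition tswap : V ⊗ W -> W ⊗ V := tlift (fun v w => w ⊗ v).

Lemma tswap_bilin : bilin (fun (v : V) (w : W) => w ⊗ v).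
Proof.
by split=> [w a v v'|v a w w']; rewrite ?linearP ?tensDl ?tensZl.
Qed.
HB.instance Definition _ :=
  GRing.isLinear.Build K (V ⊗ W)%type (W ⊗ V)%type *:%R tswap
    (tlift_linear tswap_bilin).

End Maps.

(* The canonical isomorphism u (x) (v (x) w) |-> (u (x) v) (x) w. *)
Definition tassoc U V W : U ⊗ (V ⊗ W) -> (U ⊗ V) ⊗ W :=
  tlift (fun u => tmap (tens u) idfun).

Lemma tassoc_bilin U V W : bilin (fun u : U => tmap (@tens K U V u) (@idfun W)).
Proof.
split=> [x a u u'|u]; last exact: linearP.
elim/tensor_ind: x => [|v w x IH]; first by rewrite !linear0 addr0.
by rewrite !linearD /= IH !tmapE /= !(tensDl, tensZl) addrACA.
Qed.

HB.instance Definition _ U V W :=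
  GRing.isLinear.Build K (U ⊗ (V ⊗ W))%type (U ⊗ V ⊗ W)%type *:%R (@tassoc U V W)
    (tlift_linear (tassoc_bilin U V W)).

Lemma tassocE U V W (u : U) (v : V) (w : W) :
  tassoc (u ⊗ (v ⊗ w)) = u ⊗ v ⊗ w.
Proof. by rewrite /tassoc (tlift_tens _ _ (tassoc_bilin U V W)) tmapE. Qed.

Lemma tmap_id V W : @tmap V W V W idfun idfun =1 idfun.
Proof. by apply: (@tens_ext _ _ _ (tmap idfun idfun) idfun) => v w; exact: tmapE. Qed.

Lemma tmap_comp V1 V2 V3 W1 W2 W3 (f' : {linear V2 -> V3}) (f : {linear V1 -> V2})
    (h' : {linear W2 -> W3}) (h : {linear W1 -> W2}) x :
  tmap f' h' (tmap f h x) = tmap (f' \o f) (h' \o h) x.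
Proof.
apply: (@tens_ext _ _ _ (tmap f' h' \o tmap f h) (tmap (f' \o f) (h' \o h))) => v w /=.
by rewrite !tmapE.
Qed.

End TensorTheory.

Section Subspaces.
Context {K : fieldType}.
Implicit Types V W : lmodType K.

Record subspace V (P : submodClosed V) := Subspace {
  subspace_val : V;
  _ : subspace_val \in P }.

HB.instance Definition _ V (P : submodClosed V) := [isSub for @subspace_val V P].
HB.instance Definition _ V (P : submodClosed V) := [Choice of subspace P by <:].
HB.instance Definition _ V (P : submodClosed V) :=
  [SubChoice_isSubLmodule of subspace P by <:].

Definition findim V (P : submodClosed V) : Prop :=
  exists (n : nat) (b : 'I_n -> V), (forall i, b i \in P) /\
    forall v, v \in P -> exists a : 'I_n -> K, v = \sum_(i < n) a i *: b i.

Lemma fsum_linear (I : choiceType) V W (F : I -> V -> W) :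
  (forall i, linear (F i)) ->
  (forall v, finite_set [set i | F i v <> 0]) ->
  linear (fun v => \sum_(i \in [set: I]) F i v).
Proof.
move=> Fl Ff a u v.
pose S := ([set i | F i u <> 0] `|` [set i | F i v <> 0])%classic.
have Sf : finite_set S by rewrite finite_setU.
have out i : i \notin fset_set S -> F i u = 0 /\ F i v = 0.
  rewrite in_fset_set // => /negP; rewrite inE => nS.
  by split; apply: contrapT => h; apply: nS; [left|right].
rewrite !(@fsbigTE _ _ _ _ (fset_set S)).
- rewrite scaler_sumr -big_split /=; apply: eq_bigr => i _; exact: Fl.
- by move=> i /out[].
- by move=> i /out[].
- by move=> i /out[h1 h2]; rewrite Fl h1 h2 scaler0 addr0.
Qed.

Definition direct_sum (I : choiceType) V (E : I -> submodClosed V) : Prop :=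
  forall v, exists! x : I -> V,
    [/\ forall i, x i \in E i, finite_set [set i | x i <> 0]
      & v = \sum_(i \in [set: I]) x i].

Record grading (I : choiceType) V := Grading {
  homog :> I -> submodClosed V;
  homog_direct : direct_sum homog }.

Section Component.
Variables (I : choiceType) (V : lmodType K) (G : grading I V).

Definition component (i : I) (v : V) : V := sval (cid (homog_direct G v)) i.

Lemma componentP v :
  [/\ forall i, component i v \in G i, finite_set [set i | component i v <> 0]
    & v = \sum_(i \in [set: I]) component i v].
Proof. by rewrite /component; case: cid => x []. Qed.

Lemma component_uniq v (x : I -> V) : (forall i, x i \in G i) ->
  finite_set [set i | x i <> 0] -> v = \sum_(i \in [set: I]) x i ->
  forall i, component i v = x i.
Proof.
move=> xG xf xs i; rewrite /component; case: cid => y [_ yu] /=.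
by rewrite (yu x).
Qed.

Lemma component_linear i : linear (component i).
Proof.
move=> a u v; have [uG uf us] := componentP u; have [vG vf vs] := componentP v.
apply: (@component_uniq _ (fun i => a *: component i u + component i v)) => [j||].
- by rewrite rpredD ?rpredZ.
- apply: (@sub_finite_set _ _ ([set j | component j u <> 0] `|` [set j | component j v <> 0])%classic).
    move=> j /= h; apply: contrapT => n; apply: h.
    have -> : component j u = 0 by apply: contrapT => h; apply: n; left.
    have -> : component j v = 0 by apply: contrapT => h; apply: n; right.
    by rewrite scaler0 addr0.
  by rewrite finite_setU.
- pose F j (p : V * V) := a *: component j p.1 + component j p.2.
  pose S := ([set j | component j u <> 0] `|` [set j | component j v <> 0])%classic.
  have Sf : finite_set S by rewrite finite_setU.
  have out j : j \notin fset_set S -> component j u = 0 /\ component j v = 0.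
    rewrite in_fset_set // => /negP; rewrite inE => nS.
    by split; apply: contrapT => h; apply: nS; [left|right].
  rewrite {1}us {1}vs !(@fsbigTE _ _ _ _ (fset_set S)).
  + by rewrite scaler_sumr -big_split.
  + by move=> j /out[-> ->]; rewrite scaler0 addr0.
  + by move=> j /out[].
  + by move=> j /out[].
Qed.

HB.instance Definition _ i :=
  GRing.isLinear.Build K V V *:%R (component i) (component_linear i).

Lemma component_homog i j v : v \in G i -> component j v = if j == i then v else 0.
Proof.
move=> vG; apply: (@component_uniq _ (fun j => if j == i then v else 0)) => [k||].
- by case: eqP => [->|] //; rewrite rpred0.
- apply: (@sub_finite_set _ _ [set i]) => [k /=|]; last exact: finite_set1.
  by case: eqP.
- rewrite (fsbigE [:: i]) //= => [|k _]; last by rewrite inE => /negPf ->.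
  by rewrite big_mkcond big_seq1 eqxx in_setT.
Qed.

End Component.

(* The span of the v (x) w with v in A i, w in B j and deg i + deg' j = q: the
   degree q part of the tensor product of two graded spaces. *)
Definition tensor_degree V W (I J : Type) (deg : I -> rat) (deg' : J -> rat)
    (A : I -> V -> Prop) (B : J -> W -> Prop) (q : rat) (x : V ⊗ W) : Prop :=
  exists2 s : seq (V * W), x = \sum_(p <- s) p.1 ⊗ p.2 &
    forall p, p \in s ->
      exists i j, [/\ A i p.1, B j p.2 & deg i + deg' j = q].

End Subspaces.

(* A formal series with exponents in rat is the function sending q to the
   coefficient of z^q; with several variables z0, z1, z2, the function sending
   (e0, e1, e2) to the coefficient of z0^e0 z1^e1 z2^e2. *)
Section FormalSeries.
Implicit Types (K : numFieldType) (q : rat).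

(* sum_k D k z^(-k-1) *)
Definition modes K (V W : lmodType K) (D : int -> V -> W) q (v : V) : W :=
  if q \is a Num.int then D (- Num.floor q - 1) v else 0.

Definition ddz K (V W : lmodType K) (X : rat -> V -> W) q (v : V) : W :=
  ratr (q + 1) *: X (q + 1) v.

Definition qbinom (a : rat) (j : nat) : rat :=
  (\prod_(i < j) (a - i%:R)) / j`!%:R.

(* coefficient of z^q in (1 + z)^a *)
Definition binomial_coef (a q : rat) : rat :=
  if q \is a Num.nat then qbinom a (Num.truncn q) else 0.

(* coefficient of x^p y^q in (x + eps y)^a, expanded in nonnegative powers of y *)
Definition pow_coef (eps a p q : rat) : rat :=
  if p == a - q then eps ^+ Num.truncn q * binomial_coef a q else 0.

Notation exp3 := (rat * rat * rat)%type.

(* z0^-1 delta((z1 - z2)/z0) = sum_n z0^(-n-1) (z1 - z2)^n *)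
Definition delta_012 : exp3 -> rat := fun '(e0, e1, e2) =>
  if e0 \is a Num.int then pow_coef (-1) (- e0 - 1) e1 e2 else 0.

(* z0^-1 delta((z2 - z1)/(-z0)) = sum_n (-1)^n z0^(-n-1) (z2 - z1)^n *)
Definition delta_021 : exp3 -> rat := fun '(e0, e1, e2) =>
  if e0 \is a Num.int
  then (-1) ^ Num.floor (- e0 - 1) * pow_coef (-1) (- e0 - 1) e2 e1 else 0.

(* z1^-1 delta((z2 + z0)/z1) = sum_n z1^(-n-1) (z2 + z0)^n *)
Definition delta_120 : exp3 -> rat := fun '(e0, e1, e2) =>
  if e1 \is a Num.int then pow_coef 1 (- e1 - 1) e2 e0 else 0.

(* z2^-1 delta((z1 - z0)/z2) ((z1 - z0)/z2)^a
   = sum_n z2^(-n-1-a) (z1 - z0)^(n+a) *)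
Definition delta_210 (a : rat) : exp3 -> rat := fun '(e0, e1, e2) =>
  if - e2 - 1 - a \is a Num.int then pow_coef (-1) (- e2 - 1) e1 e0 else 0.

(* The product of a scalar and a vector valued series.  The sum is over its
   finite support: wherever smul_series is used below, lower truncation
   (D k v = 0 for k << 0) leaves finitely many nonzero terms. *)
Definition smul_series K (W : lmodType K) (k : exp3 -> rat) (F : exp3 -> W) :
    exp3 -> W :=
  fun e => \sum_(d \in [set: exp3]) ratr (k d) *: F (e - d).

Section Jacobi.
Context {K : numFieldType}.
Variables V M : lmodType K.

(* (Id (x) X(z2)) X(z1) m *)
Definition iter_12 (X : rat -> M -> V ⊗ M) (m : M) : exp3 -> V ⊗ V ⊗ M :=
  fun '(e0, e1, e2) =>
    if e0 == 0 then tassoc (tmap idfun (X e2) (X e1 m)) else 0.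

(* (tau (x) Id) (Id (x) X(z1)) X(z2) m *)
Definition iter_21 (X : rat -> M -> V ⊗ M) (m : M) : exp3 -> V ⊗ V ⊗ M :=
  fun '(e0, e1, e2) =>
    if e0 == 0 then tmap (@tswap K V V) idfun (tassoc (tmap idfun (X e1) (X e2 m)))
    else 0.

(* (Y(z0) (x) Id) X(z2) m *)
Definition iter_02 (Y : rat -> V -> V ⊗ V) (X : rat -> M -> V ⊗ M) (m : M) :
    exp3 -> V ⊗ V ⊗ M :=
  fun '(e0, e1, e2) => if e1 == 0 then tmap (Y e0) idfun (X e2 m) else 0.

Definition jacobi_lhs (X : rat -> M -> V ⊗ M) (m : M) (e : exp3) : V ⊗ V ⊗ M :=
  smul_series delta_012 (iter_12 X m) e - smul_series delta_021 (iter_21 X m) e.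

(* (rho (x) Id) X(z) = sum_k L(k) z^(k-2) *)
Definition Lmode (rho : V -> K) (X : rat -> M -> V ⊗ M) (k : int) (m : M) : M :=
  tforml rho (X (k%:~R - 2) m).

Definition virasoro (L : int -> M -> M) (d : K) : Prop :=
  forall k j m, L k (L j m) - L j (L k m) =
    (k - j)%:~R *: L (k + j) m
    + ((k ^+ 3 - k)%:~R / 12 * (k + j == 0)%:R * d) *: m.

End Jacobi.
End FormalSeries.

Record gvoc (R : realType) := Gvoc {
  voc_space :> lmodType R[i];
  voc_gr : grading int voc_space;
  voc_D : int -> {linear voc_space -> (voc_space ⊗ voc_space)%type};
  voc_c : {scalar voc_space};
  voc_rho : {scalar voc_space};
  voc_d : R[i];
  voc_Y := modes voc_D : rat -> voc_space -> voc_space ⊗ voc_space;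
  voc_L := Lmode voc_rho voc_Y : int -> voc_space -> voc_space;
  voc_findim : forall s, findim (voc_gr s);
  voc_bounded : exists N : int, forall s v, s < N -> v \in voc_gr s -> v = 0;
  voc_trunc : forall v, exists N : int, forall k, k < N -> voc_D k v = 0;
  voc_degree : forall k s v, v \in voc_gr s ->
    tensor_degree intr intr (fun t u => u \in voc_gr t) (fun t u => u \in voc_gr t)
      (s + k + 1)%:~R (voc_D k v);
  voc_counit : forall q v, tforml voc_c (voc_Y q v) = if q == 0 then v else 0;
  voc_cocreation_pos : forall q v,
    q \isn't a Num.nat -> tformr voc_c (voc_Y q v) = 0;
  voc_cocreation : forall v, tformr voc_c (voc_Y 0 v) = v;
  voc_jacobi : forall v e,
    jacobi_lhs voc_Y v e = smul_series delta_120 (iter_02 voc_Y voc_Y v) e;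
  voc_virasoro : virasoro voc_L voc_d;
  voc_L0 : forall s v, v \in voc_gr s <-> voc_L 0 v = s%:~R *: v;
  voc_L1 : forall q v, tmap (voc_L 1) idfun (voc_Y q v) = ddz voc_Y q v }.

Record gvoc_aut (R : realType) (V : gvoc R) (g : {linear V -> V}) : Prop := {
  aut_bij : bijective g;
  aut_c : forall v, voc_c V (g v) = voc_c V v;
  aut_rho : forall v, voc_rho V (g v) = voc_rho V v;
  aut_Y : forall q v, voc_Y q (g v) = tmap g g (voc_Y q v) }.

Definition has_order (V : Type) (g : V -> V) (T : nat) : Prop :=
  [/\ (0 < T)%N, iter T g =1 id
    & forall j, (0 < j < T)%N -> ~ (iter j g =1 id)].

Section Eigenspaces.
Context {R : realType} {V : lmodType R[i]}.
Variables (g : {linear V -> V}) (T : nat).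

(* exp(2 pi i r / T) *)
Definition unity_root (r : nat) : R[i] :=
  let t := 2 * pi * r%:R / T%:R in (cos t +i* sin t)%C.

Definition eigen (r : nat) (v : V) : Prop := g v = unity_root r *: v.

(* The projection onto eigen r along the eigen r', r' < T different from r,
   when g has order T: see eigenprojP, eigenproj_eigen and eigenproj_sum. *)
Definition eigenproj (r : nat) (v : V) : V :=
  T%:R^-1 *: \sum_(j < T) unity_root r ^- j *: iter j g v.

Lemma iter_linear j : linear (iter j g).
Proof. by elim: j => [|j IH] a u v //; rewrite !iterS IH linearP. Qed.

Lemma eigenproj_linear r : linear (eigenproj r).
Proof.
move=> a u v; rewrite /eigenproj scalerA mulrC -scalerA -scalerDr; congr (_ *: _).
rewrite scaler_sumr -big_split; apply: eq_bigr => j _ /=.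
by rewrite iter_linear scalerDr !scalerA mulrC.
Qed.

HB.instance Definition _ r :=
  GRing.isLinear.Build R[i] V V *:%R (eigenproj r) (eigenproj_linear r).

End Eigenspaces.

Section EigenTheory.
Context {R : realType} {V : lmodType R[i]}.
Variables (g : {linear V -> V}) (T : nat).
Hypothesis T_gt0 : (0 < T)%N.
Local Notation w := (unity_root T).

Lemma unity_rootD r s : w (r + s) = w r * w s :> R[i].
Proof.
rewrite /unity_root natrD mulrDr mulrDl cosD sinD.
by apply/eqP; rewrite eq_complex /= eqxx /= addrC.
Qed.

Lemma unity_rootX r j : w r ^+ j = w (r * j) :> R[i].
Proof.
elim: j => [|j IH]; last by rewrite mulnS unity_rootD exprS IH.
by rewrite muln0 /unity_root mulr0 mul0r cos0 sin0.
Qed.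

Lemma unity_root_pow r : w r ^+ T = 1 :> R[i].
Proof.
rewrite unity_rootX mulnC -unity_rootX; set z := w T.
suff -> : z = 1 by rewrite expr1n.
rewrite /z /unity_root mulfK ?pnatr_eq0 -?lt0n //.
by rewrite mulr_natl cos2pi sin2pi.
Qed.

Lemma unity_root_neq0 r : w r != 0 :> R[i].
Proof.
apply/negP => /eqP h; have := unity_root_pow r.
by rewrite h expr0n gtn_eqF // => /eqP; rewrite eq_sym oner_eq0.
Qed.

Lemma unity_root_neq1 r : (0 < r < T)%N -> w r != 1 :> R[i].
Proof.
move=> /andP[r0 rT]; apply/negP => /eqP[] + _.
set t := (X in cos X) => ct.
have pi0 : 0 < pi :> R := pi_gt0 R.
have T0 : 0 < T%:R :> R by rewrite ltr0n.
have t0 : 0 < t by rewrite /t !mulr_gt0 ?invr_gt0 ?ltr0n.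
have t2 : t < 2 * pi by rewrite /t ltr_pdivrMr // ltr_pM2l ?mulr_gt0 // ltr_nat.
have key (u : R) : 0 < u -> u <= pi -> cos u = 1 -> False.
  move=> u0 up; rewrite -cos0 => /cos_inj h.
  have : u = 0 by apply: h; rewrite in_itv /= ?lexx ?(ltW u0) ?up ?(ltW pi0).
  by move=> uE; rewrite uE ltxx in u0.
have [tp|tp] := leP t pi; first exact: key t0 tp ct.
apply: (key (pi *+ 2 - t)).
- by rewrite subr_gt0 -mulr_natl.
- by rewrite lerBlDr mulr2n lerD2l ltW.
- by rewrite addrC cosD2pi cosN.
Qed.

Lemma sum_pow_eq0 (z : R[i]) : z ^+ T = 1 -> z != 1 -> \sum_(j < T) z ^+ j = 0.
Proof.
case: T => [|n]; first by rewrite big_ord0.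
by move=> /eqP; rewrite expfS_eq1 => /orP[->//|/eqP].
Qed.

Lemma natT_neq0 : T%:R != 0 :> R[i].
Proof. by rewrite pnatr_eq0 -lt0n. Qed.

Lemma unity_root_inj r s : (r < T)%N -> (s < T)%N -> w r = w s :> R[i] -> r = s.
Proof.
wlog le_sr : r s / (s <= r)%N => [H rT sT e|rT sT].
  by case: (leqP s r) => [|/ltnW] h; [exact: H|exact/esym/H].
rewrite -[r in w r](subnK le_sr) unity_rootD -[RHS]mul1r.
move=> /(mulIf (unity_root_neq0 s)) e.
apply/eqP; rewrite eqn_leq le_sr andbT leqNgt; apply/negP => sr.
have : w (r - s) != 1 :> R[i].
  by apply: unity_root_neq1; rewrite subn_gt0 sr (leq_ltn_trans (leq_subr s r)).
by rewrite e eqxx.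
Qed.

Lemma eigenproj_eigen r s v : (r < T)%N -> (s < T)%N -> eigen g T r v ->
  eigenproj g T s v = if s == r then v else 0.
Proof.
move=> rT sT rv.
have it j : iter j g v = w r ^+ j *: v.
  elim: j => [|j IH]; first by rewrite scale1r.
  by rewrite iterS IH linearZ /= rv scalerA exprSr.
have -> : eigenproj g T s v = (T%:R^-1 * \sum_(j < T) (w r / w s) ^+ j) *: v.
  rewrite /eigenproj -scalerA scaler_suml; congr (_ *: _).
  by apply: eq_bigr => j _; rewrite it scalerA exprMn exprVn mulrC.
case: eqP => [->|/eqP sr].
  rewrite divff ?unity_root_neq0 //.
  under eq_bigr do rewrite expr1n.
  by rewrite sumr_const card_ord mulVf ?natT_neq0 // scale1r.
rewrite sum_pow_eq0 ?mulr0 ?scale0r //.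
  by rewrite exprMn exprVn !unity_root_pow invr1 mulr1.
apply/negP => /eqP h; case/negP: sr; apply/eqP/esym.
by apply: unity_root_inj => //; rewrite -[LHS](divfK (unity_root_neq0 s)) h mul1r.
Qed.

Lemma eigenproj_sum v : \sum_(r < T) eigenproj g T r v = v.
Proof.
rewrite /eigenproj -scaler_sumr exchange_big /=.
under eq_bigr => j _.
  rewrite -scaler_suml.
  have -> : \sum_(r < T) w r ^- j = if j == 0%N :> nat then T%:R else 0 :> R[i].
    under eq_bigr => r _ do rewrite unity_rootX mulnC -unity_rootX -exprVn.
    case: eqP => [->|/eqP j0].
      under eq_bigr => r _ do
        rewrite /unity_root mulr0 mul0r cos0 sin0 -[(_ +i* _)%C]/(1 : R[i]) invr1 expr1n.
      by rewrite sumr_const card_ord.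
    rewrite sum_pow_eq0 //; first by rewrite exprVn unity_root_pow invr1.
    by rewrite invr_eq1 unity_root_neq1 // lt0n j0 ltn_ord.
  over.
rewrite (bigD1 (Ordinal T_gt0)) //= big1 => [|j j0]; last first.
  by rewrite -val_eqE /= in j0; rewrite (negPf j0) scale0r.
by rewrite addr0 scalerA mulVf ?natT_neq0 // scale1r.
Qed.

Lemma eigenprojP r v : iter T g =1 id -> eigen g T r (eigenproj g T r v).
Proof.
move=> gT; rewrite /eigen /eigenproj linearZ /= scalerA mulrC -scalerA.
congr (_ *: _); rewrite linear_sum /= scaler_sumr.
pose F j := w r ^- j *: iter j g v.
have FT : F T = F 0%N by rewrite /F unity_root_pow gT expr0.
transitivity (\sum_(j < T) w r *: F j.+1).
  apply: eq_bigr => j _; rewrite linearZ /F iterS scalerA exprS invfM mulrA.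
  by rewrite divff ?unity_root_neq0 // mul1r.
have shift n : F n = F 0%N -> \sum_(j < n) F j.+1 = \sum_(j < n) F j.
  case: n => [|n] Fn; first by rewrite !big_ord0.
  by rewrite big_ord_recr /= Fn [RHS]big_ord_recl addrC.
by rewrite -!scaler_sumr (shift T FT).
Qed.

End EigenTheory.

Section TwistedComodules.
Context {R : realType}.
Variables (V : gvoc R) (g : {linear V -> V}) (T : nat).

(* sum_k (z^(- ln g / (2 pi i)) (x) Id) D k z^(-k-1), the operator
   z^(- ln g / (2 pi i)) being multiplication by z^(-r/T) on eigen r. *)
Definition twisted_modes (M : lmodType R[i]) (D : int -> M -> V ⊗ M)
    (q : rat) (m : M) : V ⊗ M :=
  \sum_(r < T) tmap (eigenproj g T r) idfun (modes D (q + r%:R / T%:R) m).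

Record weak_comodule := WeakComodule {
  wc_space :> lmodType R[i];
  wc_D : int -> {linear wc_space -> (V ⊗ wc_space)%type};
  wc_Y := twisted_modes wc_D : rat -> wc_space -> V ⊗ wc_space;
  wc_L := Lmode (voc_rho V) wc_Y : int -> wc_space -> wc_space;
  wc_trunc : forall m, exists N : int, forall k, k < N -> wc_D k m = 0;
  wc_counit : forall q m, tforml (voc_c V) (wc_Y q m) = if q == 0 then m else 0;
  wc_jacobi : forall m e,
    jacobi_lhs wc_Y m e =
    \sum_(r < T) smul_series (delta_210 (- (r%:R / T%:R)))
      (fun d => tmap (tmap (eigenproj g T r) idfun) idfun
                  (iter_02 (@voc_Y R V) wc_Y m d)) e;
  wc_virasoro : virasoro wc_L (voc_d V);
  wc_L1 : forall q m,
    tmap (@voc_L R V 1) idfun (wc_Y q m) = ddz wc_Y q m;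
  wc_L1_comm : forall q m,
    ddz wc_Y q m = wc_Y q (wc_L 1 m) - tmap idfun (wc_L 1) (wc_Y q m) }.

(* Index n of the grading stands for degree n / T. *)
Record adm_comodule := AdmComodule {
  ac_weak :> weak_comodule;
  ac_gr : grading nat ac_weak;
  ac_degree : forall k n m, m \in ac_gr n ->
    exists2 x : 'I_T -> V ⊗ ac_weak, wc_D ac_weak k m = \sum_r x r &
      forall r : 'I_T, tensor_degree intr (fun n => n%:R / T%:R)
        (fun s v => v \in voc_gr V s /\ eigen g T r v) (fun n m => m \in ac_gr n)
        (n%:R / T%:R + k%:~R + 1 + r%:R / T%:R) (x r) }.

Record adm_hom (M1 M2 : adm_comodule) := AdmHom {
  adm_fun :> M1 -> M2;
  adm_linear : linear adm_fun;
  adm_gr : forall n m, m \in ac_gr M1 n -> adm_fun m \in ac_gr M2 n;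
  adm_Y : forall q m,
    tmap idfun adm_fun (@wc_Y M1 q m) = @wc_Y M2 q (adm_fun m) }.

HB.instance Definition _ M1 M2 (f : adm_hom M1 M2) :=
  GRing.isLinear.Build R[i] M1 M2 *:%R (adm_fun f) (adm_linear f).

Lemma adm_hom_ext M1 M2 (f h : adm_hom M1 M2) : adm_fun f =1 adm_fun h -> f = h.
Proof.
move=> /funext; case: f h => [f f1 f2 f3] [h h1 h2 h3] /= fh.
by subst h; congr AdmHom; exact: Prop_irrelevance.
Qed.

Lemma adm_id_linear (M : adm_comodule) : linear (@idfun M).
Proof. by []. Qed.
Lemma adm_id_gr (M : adm_comodule) n (m : M) :
  m \in ac_gr M n -> idfun m \in ac_gr M n.
Proof. by []. Qed.
Lemma adm_id_Y (M : adm_comodule) q (m : M) :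
  tmap idfun idfun (@wc_Y M q m) = @wc_Y M q (idfun m).
Proof. exact: tmap_id. Qed.
Definition adm_id M : adm_hom M M :=
  AdmHom (@adm_id_linear M) (@adm_id_gr M) (@adm_id_Y M).

Section Composition.
Variables (M1 M2 M3 : adm_comodule) (f : adm_hom M1 M2) (h : adm_hom M2 M3).
Lemma adm_comp_linear : linear (h \o f).
Proof. exact: linearP. Qed.
Lemma adm_comp_gr n m : m \in ac_gr M1 n -> (h \o f) m \in ac_gr M3 n.
Proof. by move=> /(adm_gr f) /(adm_gr h). Qed.
Lemma adm_comp_Y q m :
  tmap idfun (h \o f) (@wc_Y M1 q m) = @wc_Y M3 q ((h \o f) m).
Proof.
by rewrite /= -adm_Y -adm_Y; apply/esym/(tmap_comp idfun idfun h f).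
Qed.
Definition adm_comp : adm_hom M1 M3 := AdmHom adm_comp_linear adm_comp_gr adm_comp_Y.
End Composition.

End TwistedComodules.

Record category := Category {
  cat_ob :> Type;
  cat_hom : cat_ob -> cat_ob -> Type;
  cat_id : forall X, cat_hom X X;
  cat_comp : forall X Y Z, cat_hom X Y -> cat_hom Y Z -> cat_hom X Z;
  cat_idl : forall X Y (f : cat_hom X Y), cat_comp (cat_id X) f = f;
  cat_idr : forall X Y (f : cat_hom X Y), cat_comp f (cat_id Y) = f;
  cat_compA : forall W X Y Z (f : cat_hom W X) (h : cat_hom X Y) (k : cat_hom Y Z),
    cat_comp f (cat_comp h k) = cat_comp (cat_comp f h) k }.

Record is_functor (A B : category) (Fo : A -> B)
    (Fm : forall X Y : A, cat_hom X Y -> cat_hom (Fo X) (Fo Y)) : Prop := IsFunctor {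
  functor_id : forall X : A, Fm X X (cat_id X) = cat_id (Fo X);
  functor_comp : forall (X Y Z : A) (f : cat_hom X Y) (h : cat_hom Y Z),
    Fm X Z (cat_comp f h) = cat_comp (Fm X Y f) (Fm Y Z h) }.
Arguments is_functor {A B} Fo Fm.

Definition adm_category (R : realType) (V : gvoc R) (g : {linear V -> V}) (T : nat) :
  category.
Proof.
refine (@Category (adm_comodule g T) (@adm_hom R V g T) (@adm_id R V g T)
  (@adm_comp R V g T) _ _ _).
- by move=> X Y f; apply: adm_hom_ext.
- by move=> X Y f; apply: adm_hom_ext.
- by move=> W X Y Z f h k; apply: adm_hom_ext.
Defined.

Section Coalgebras.
Context {K : fieldType}.

Record coalgebra_on (C : lmodType K) := CoalgebraOn {
  coprod : {linear C -> (C ⊗ C)%type};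
  counit : {scalar C};
  coprodA : forall x,
    tassoc (tmap idfun coprod (coprod x)) = tmap coprod idfun (coprod x);
  counit_left : forall x, tforml counit (coprod x) = x;
  counit_right : forall x, tformr counit (coprod x) = x }.

Variables (C : lmodType K) (A : coalgebra_on C).

Definition is_coaction (N : lmodType K) (lam : N -> C ⊗ N) : Prop :=
  (forall n, tassoc (tmap idfun lam (lam n)) = tmap (coprod A) idfun (lam n)) /\
  (forall n, tforml (counit A) (lam n) = n).

Record comodule := Comodule {
  com_space :> lmodType K;
  coact : {linear com_space -> (C ⊗ com_space)%type};
  coactP : is_coaction coact }.

Record comodule_hom (N1 N2 : comodule) := ComoduleHom {
  com_fun :> N1 -> N2;
  com_linear : linear com_fun;
  com_coact : forall n, tmap idfun com_fun (coact N1 n) = coact N2 (com_fun n) }.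

HB.instance Definition _ N1 N2 (f : comodule_hom N1 N2) :=
  GRing.isLinear.Build K N1 N2 *:%R (com_fun f) (com_linear f).

Lemma comodule_hom_ext N1 N2 (f h : comodule_hom N1 N2) :
  com_fun f =1 com_fun h -> f = h.
Proof.
move=> /funext; case: f h => [f f1 f2] [h h1 h2] /= fh.
by subst h; congr ComoduleHom; exact: Prop_irrelevance.
Qed.

Lemma com_id_linear (N : comodule) : linear (@idfun N).
Proof. by []. Qed.
Lemma com_id_coact (N : comodule) (n : N) :
  tmap idfun idfun (coact N n) = coact N (idfun n).
Proof. exact: tmap_id. Qed.
Definition com_id N : comodule_hom N N :=
  ComoduleHom (@com_id_linear N) (@com_id_coact N).

Section Composition.
Variables (N1 N2 N3 : comodule) (f : comodule_hom N1 N2) (h : comodule_hom N2 N3).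
Lemma com_comp_linear : linear (h \o f).
Proof. exact: linearP. Qed.
Lemma com_comp_coact n : tmap idfun (h \o f) (coact N1 n) = coact N3 ((h \o f) n).
Proof.
by rewrite /= -com_coact -com_coact; apply/esym/(tmap_comp idfun idfun h f).
Qed.
Definition com_comp : comodule_hom N1 N3 := ComoduleHom com_comp_linear com_comp_coact.
End Composition.

Definition comodule_category : category.
Proof.
refine (@Category comodule comodule_hom com_id com_comp _ _ _).
- by move=> X Y f; apply: comodule_hom_ext.
- by move=> X Y f; apply: comodule_hom_ext.
- by move=> W X Y Z f h k; apply: comodule_hom_ext.
Defined.

End Coalgebras.

Section Residues.
Context {R : realType}.
Variables (V : gvoc R) (g : {linear V -> V}) (T : nat).

(* Elements of prod_n (V (x) M)_n are represented by their components in the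
   V_i (x) M_j, (V (x) M)_n being the direct sum of those with
   deg i + deg j = n. *)
Definition bicomponent (M : lmodType R[i]) (J : choiceType) (H : grading J M)
    (x : V ⊗ M) (i : int) (j : J) : V ⊗ M :=
  tmap (component (voc_gr V) i) (component H j) x.

(* Res_z (F(z) (x) Id) X(z), where F(z) acts on V_i \cap eigen r as the scalar
   series sum_q (f i r q) z^q. *)
Definition residue (M : lmodType R[i]) (J : choiceType) (H : grading J M)
    (f : int -> nat -> rat -> rat) (X : rat -> V ⊗ M) (i : int) (j : J) : V ⊗ M :=
  \sum_(r < T) \sum_(q \in [set: rat])
    ratr (f i r (- 1 - q)) *:
      tmap (eigenproj g T r) idfun (bicomponent H (X q) i j).

(* (1 + z)^(L(0) - 1 + delta_0 + ln g / (2 pi i)) / z^(1 + delta_0) *)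
Definition Cg_weight (s : int) (r : nat) (q : rat) : rat :=
  let d := (r == 0%N)%:R in
  binomial_coef (s%:~R - 1 + d + r%:R / T%:R) (q + 1 + d).

(* delta_0 o (1 + z)^L(0) / z *)
Definition coprod_weight (s : int) (r : nat) (q : rat) : rat :=
  (r == 0%N)%:R * binomial_coef s%:~R (q + 1).

(* z^(L(0) - 1) *)
Definition coact_weight (s : int) (r : nat) (q : rat) : rat := (q == s%:~R - 1)%:R.

Lemma tensor_degree_bicomponent (M : lmodType R[i]) (J : choiceType)
    (H : grading J M) (deg : J -> rat) q x i j :
  tensor_degree intr deg (fun s v => v \in voc_gr V s) (fun t m => m \in H t) q x ->
  i%:~R + deg j != q -> bicomponent H x i j = 0.
Proof.
case=> s -> sP ne; rewrite /bicomponent linear_sum big1_seq // => p /andP[_ /sP].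
case=> i' [j' [h1 h2 h3]]; rewrite /= tmapE /= (component_homog _ h1) (component_homog _ h2).
case: eqP => [ii|_]; last by rewrite tens0l.
case: eqP => [jj|_]; last by rewrite linear0.
by case/eqP: ne; rewrite ii jj.
Qed.

Lemma modes_linear (U W : lmodType R[i]) (D : int -> {linear U -> W}) q :
  linear (modes D q).
Proof.
by move=> a u v; rewrite /modes; case: ifP; rewrite ?linearP ?scaler0 ?addr0.
Qed.

Lemma voc_Y_support v i j :
  finite_set [set q | bicomponent (voc_gr V) (@voc_Y R V q v) i j <> 0].
Proof.
have [cG cf cs] := componentP (voc_gr V) v.
pose S := ([set u : int | component (voc_gr V) u v <> 0])%classic.
apply: (@sub_finite_set _ _ ((fun u : int => (u - i - j)%:~R : rat) @` S)%classic); last exact: finite_image.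
move=> q /= h; apply: contrapT => nS; apply: h.
rewrite /voc_Y /modes; case: ifPn => [qZ|_]; last by rewrite /bicomponent linear0.
rewrite {1}cs (@fsbigTE _ _ _ _ (fset_set S)); last first.
  move=> u; rewrite in_fset_set // => /negP; rewrite inE => nu.
  by apply: contrapT => h; apply: nu.
rewrite linear_sum /bicomponent linear_sum big1_seq // => u /andP[_].
rewrite in_fset_set // inE => uS.
apply: tensor_degree_bicomponent (voc_degree _ (cG u)) _.
apply/negP => /eqP e; apply: nS; exists u => //.
rewrite -(floorK qZ); move: e; rewrite -intrD => /intr_inj e.
by congr (_%:~R); apply/eqP; rewrite -addrA -opprD e !opprD !opprK; apply/eqP; ring.
Qed.

Lemma residue_linear (f : int -> nat -> rat -> rat) i j :
  linear (fun v => residue (voc_gr V) f (fun q => @voc_Y R V q v) i j).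
Proof.
move=> a u v; rewrite /residue scaler_sumr -big_split; apply: eq_bigr => r _ /=.
pose F q w : V ⊗ V := ratr (f i r (- 1 - q)) *:
  tmap (eigenproj g T r) idfun (bicomponent (voc_gr V) (@voc_Y R V q w) i j).
apply: (@fsum_linear _ _ _ _ F) => [q b x y|w].
  rewrite /F /voc_Y modes_linear /bicomponent linearP linearP scalerDr !scalerA.
  by rewrite [b * _]mulrC.
apply: sub_finite_set (voc_Y_support w i j) => q /= h e; apply: h.
by rewrite /F e linear0 scaler0.
Qed.

Definition Cg_pred : {pred V} := fun v =>
  `[< forall i j, residue (voc_gr V) Cg_weight (fun q => @voc_Y R V q v) i j = 0 >].

Lemma Cg_submod_closed : submod_closed Cg_pred.
Proof.
have P (v : V) : reflect (forall i j,
    residue (voc_gr V) Cg_weight (fun q => @voc_Y R V q v) i j = 0) (v \in Cg_pred).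
  exact: asboolP.
have lin i j a u v := @residue_linear Cg_weight i j a u v.
split.
  apply/P => i j; have := lin i j 1 0 0; rewrite !scale1r addr0 => /eqP.
  by rewrite -subr_eq subrr => /eqP.
by move=> a u v /P uC /P vC; apply/P => i j; rewrite lin uC vC scaler0 addr0.
Qed.

HB.instance Definition _ :=
  GRing.isSubmodClosed.Build R[i] V Cg_pred Cg_submod_closed.

Definition Cg : submodClosed V := Cg_pred.

Definition Delta_g (v : V) : int -> int -> V ⊗ V :=
  residue (voc_gr V) coprod_weight (fun q => @voc_Y R V q v).

Record Cg_coalgebra := CgCoalgebra {
  cg_coalg :> coalgebra_on (subspace Cg);
  cg_counit : forall v, counit cg_coalg v = voc_c V (subspace_val v);
  cg_coprod : forall (v : subspace Cg) i j,
    bicomponent (voc_gr V)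
      (tmap (@subspace_val _ _ Cg) (@subspace_val _ _ Cg) (coprod cg_coalg v)) i j
    = Delta_g (subspace_val v) i j }.

Definition Delta_M0 (M : adm_comodule g T) (m : M) : int -> nat -> V ⊗ M :=
  residue (ac_gr M) coact_weight (fun q => @wc_Y _ _ _ _ M q m).

Variable A : Cg_coalgebra.

Record M0_comodule (M : adm_comodule g T) := M0Comodule {
  m0_coact : {linear subspace (ac_gr M 0) -> (subspace Cg ⊗ subspace (ac_gr M 0))%type};
  m0_coactP : is_coaction A m0_coact;
  m0_coactE : forall (m : subspace (ac_gr M 0)) i n,
    bicomponent (ac_gr M)
      (tmap (@subspace_val _ _ Cg) (@subspace_val _ _ (ac_gr M 0)) (m0_coact m)) i n
    = Delta_M0 (subspace_val m) i n }.

Definition Omega (M : adm_comodule g T) (S : M0_comodule M) : comodule A :=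
  Comodule (m0_coactP S).

End Residues.

(* Main.v *)
From HB Require Import structures.
Require Import Defs.
From mathcomp Require Import all_boot all_order all_algebra complex reals.
From mathcomp Require Import finmap boolp classical_sets cardinality fsbigop.

(** The residue defining the coaction on degree 0 is built from the modes of
    Upsilon_M by the projections onto the V^(r), onto the V_i and onto the M_n.
    The first two act on the factor V alone, so they commute with Id (x) psi;
    the third commutes with psi because psi preserves the grading; and the
    modes commute with psi by the definition of a homomorphism.  Hence
    Id (x) psi carries the residue of m to the residue of psi m
    (Delta_M0_natural).

    The residue is a family of elements of V (x) M, whereas the coaction of the
    comodule M_0 takes its values in C_g(V) (x) M_0.  To descend, two facts are
    needed: an element of V (x) M is determined by its bihomogeneous components
    (bicomponent_inj), and over a field the tensor product of two inclusions of
    subspaces is injective (tmap_val_inj), since every subspace has a complement.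
    The equation for the restriction of psi to M_0 can then be checked after
    embedding in V (x) M, where it is the naturality of the residue.
    Functoriality holds because homomorphisms of comodules are compared
    pointwise, and restriction respects identities and composites. *)

Set Implicit Arguments.
Unset Strict Implicit.
Unset Printing Implicit Defensive.

Import GRing.Theory.
Local Open Scope ring_scope.

(** * Tensor products of subspaces *)

(** A subset closed under combinations and meeting P trivially that is maximal
    for these two properties is a complement: a vector v outside P + Q would
    allow the enlargement Kv + Q.  Both properties pass to unions of chains, so
    Zorn's lemma applies; the empty set also has them, which is why Q 0 needs
    an argument of its own. *)
Lemma exists_complement (K : fieldType) (V : lmodType K) (P : submodClosed V) :
  exists Q : set V, [/\ Q 0,
    forall (a : K) u v, Q u -> Q v -> Q (a *: u + v),
    forall u, Q u -> u \in P -> u = 0 &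
    forall v, exists2 p, p \in P & Q (v - p)].
Proof.
pose good (Q : set V) :=
  (forall (a : K) u v, Q u -> Q v -> Q (a *: u + v)) /\
  (forall u, Q u -> u \in P -> u = 0).
have [F Fgood Ftot|Q [[Qlin QP] Qmax]] := @Zorn_bigcup _ good.
  split=> [a u v [A FA Au] [B FB Bv]|u [A FA Au]]; last exact: (Fgood A FA).2.
  have [AB|BA] := Ftot A B FA FB.
    by exists B => //; apply: (Fgood B FB).1 => //; exact: AB.
  by exists A => //; apply: (Fgood A FA).1 => //; exact: BA.
(* If Q were empty, {0} would be strictly larger. *)
have Q0 : Q 0.
  have [[u Qu]|noQ] := pselect (exists u, Q u).
    by have := Qlin (-1) u u Qu Qu; rewrite scaleN1r addNr.
  exfalso; apply: (Qmax [set 0]%classic); last first.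
    by split=> [a u v -> ->|u ->]; rewrite ?scaler0 ?addr0.
  split=> [u Qu|/(_ 0 erefl) Q0]; first by case: noQ; exists u.
  by apply: noQ; exists 0.
exists Q; split=> // v; apply: contrapT => nv.
pose Qv := [set x | exists a q, Q q /\ x = a *: v + q]%classic.
have QN u : Q u -> Q (- u).
  by move=> Qu; rewrite -scaleN1r -[_ *: _]addr0; exact: Qlin.
apply: (Qmax Qv).
  split=> [u Qu|h]; first by exists 0, u; rewrite scale0r add0r.
  apply: nv; exists 0; rewrite ?rpred0 // subr0; apply: h.
  by exists 1, 0; rewrite scale1r addr0.
split=> [a _ _ [b [q [Qq ->]]] [c [q' [Qq' ->]]]|u [a [q [Qq ->]]] uP].
  exists (a * b + c), (a *: q + q'); split; first exact: Qlin.
  by rewrite scalerDl scalerDr scalerA addrACA.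
(* For a != 0, a v + q in P puts v in P + Q, against the choice of v. *)
have [a0|a0] := eqVneq a 0.
  by move: uP; rewrite a0 scale0r add0r => uP; exact: QP.
exfalso; apply: nv; exists (a^-1 *: (a *: v + q)); first by rewrite rpredZ.
rewrite scalerDr scalerA mulVf // scale1r opprD addrA subrr add0r.
by apply: QN; rewrite -[_ *: _]addr0; exact: Qlin.
Qed.

Lemma subspace_valP (K : fieldType) (V : lmodType K) (P : submodClosed V)
    (p : subspace P) : subspace_val p \in P.
Proof. by case: p. Qed.

HB.instance Definition _ (K : fieldType) (V : lmodType K) (P : submodClosed V) :=
  GRing.isLinear.Build K (subspace P) V *:%R (@subspace_val K V P)
    (linearP (\val : {linear subspace P -> V})).

(** The retraction is the projection onto P along a complement. *)
Lemma subspace_retract (K : fieldType) (V : lmodType K) (P : submodClosed V) :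
  exists r : {linear V -> subspace P}, cancel (@subspace_val _ _ P) r.
Proof.
have [Q [Q0 Qlin QP Qex]] := exists_complement P.
have ex v : exists p : subspace P, Q (v - subspace_val p).
  by have [p pP Qp] := Qex v; exists (Subspace pP).
pose r v := sval (cid (ex v)).
have rE v p : Q (v - subspace_val p) -> r v = p.
  rewrite /r; case: cid => p' /= Qp' Qp; apply/val_inj/eqP; rewrite -subr_eq0.
  apply/eqP/QP; last first.
    by rewrite -scaleN1r rpredD ?rpredZ ?subspace_valP.
  have := Qlin (-1) _ _ Qp' Qp.
  by rewrite scaleN1r opprB addrA subrK.
have rlin : linear r.
  move=> a u v; apply: rE; rewrite /r; case: cid => p Qp; case: cid => q Qq /=.
  have := Qlin a _ _ Qp Qq.
  by rewrite linearP /= scalerDr addrACA.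
pose R : {linear V -> subspace P} := HB.pack r (GRing.isLinear.Build _ _ _ _ r rlin).
by exists R => p; apply: rE; rewrite subrr.
Qed.

(** The tensor product of two retractions is a left inverse.  This is what
    allows equations in C (x) N to be checked in an ambient V (x) W. *)
Lemma tmap_val_inj (K : fieldType) (V W : lmodType K) (P : submodClosed V)
    (Q : submodClosed W) :
  injective (tmap (@subspace_val _ _ P) (@subspace_val _ _ Q)).
Proof.
have [r rK] := subspace_retract P; have [s sK] := subspace_retract Q.
apply: (can_inj (g := tmap r s)) => x; rewrite tmap_comp -[RHS]tmap_id.
by congr (tmap _ _ _); apply/funext => u; [exact: rK|exact: sK].
Qed.

(** * Graded components *)

(** The images of the components of v form a decomposition of f v, and
    decompositions are unique. *)
Lemma component_morph (K : fieldType) (I : choiceType) (V W : lmodType K)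
    (G : grading I V) (H : grading I W) (f : {linear V -> W}) :
  (forall i v, v \in G i -> f v \in H i) ->
  forall i v, f (component G i v) = component H i (f v).
Proof.
move=> fgr i v; have [vG vfin vsum] := componentP G v.
symmetry; apply: (component_uniq (x := fun j => f (component G j v))).
- by move=> j; exact: fgr.
- by apply: sub_finite_set vfin => j /= h e; apply: h; rewrite e linear0.
- pose S := fset_set [set j | component G j v <> 0]%classic.
  have out j : j \notin S -> component G j v = 0.
    by rewrite in_fset_set // notin_setE /= => /contrapT.
  rewrite {1}vsum !(@fsbigTE _ _ _ _ S) ?linear_sum // => j /out -> //.
  exact: linear0.
Qed.

(** Each of the finitely many pure tensors of x involves finitely many
    components. *)
Lemma tens_component_sum (K : fieldType) (I J : choiceType) (V W : lmodType K)
    (G : grading I V) (H : grading J W) (x : V ⊗ W) :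
  exists (A : {fset I}) (B : {fset J}),
    x = \sum_(i <- A) \sum_(j <- B) tmap (component G i) (component H j) x.
Proof.
(* The induction needs index sets that may be enlarged at will, in order to
   use common ones for the two summands. *)
suff [A [B AB]] : exists (A : {fset I}) (B : {fset J}),
    forall A' B', (A `<=` A')%fset -> (B `<=` B')%fset ->
    x = \sum_(i <- A') \sum_(j <- B') tmap (component G i) (component H j) x.
  by exists A, B; exact: AB.
move: x; apply: tensor_ind => [|v w x [A [B IH]]].
  exists fset0, fset0 => A' B' _ _.
  by rewrite big1 // => i _; rewrite big1 // => j _; exact: linear0.
have [_ vfin vsum] := componentP G v.
have [_ wfin wsum] := componentP H w.
exists (fset_set [set i | component G i v <> 0]%classic `|` A)%fset.
exists (fset_set [set j | component H j w <> 0]%classic `|` B)%fset.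
move=> A' B'; rewrite !fsubUset => /andP[vA AA'] /andP[wB BB'].
have vE : v = \sum_(i <- A') component G i v.
  rewrite {1}vsum; apply: fsbigTE => i iA'; apply: contrapT => vi.
  by case/negP: iA'; apply: (fsubsetP vA); rewrite in_fset_set // inE.
have wE : w = \sum_(j <- B') component H j w.
  rewrite {1}wsum; apply: fsbigTE => j jB'; apply: contrapT => wj.
  by case/negP: jB'; apply: (fsubsetP wB); rewrite in_fset_set // inE.
have vwE : v ⊗ w =
    \sum_(i <- A') \sum_(j <- B') tmap (component G i) (component H j) (v ⊗ w).
  rewrite {1}vE {1}wE; elim: (A' : seq _) => [|i s IHs].
    by rewrite !big_nil tens0l.
  rewrite !big_cons tensDl IHs; congr (_ + _).
  by rewrite linear_sum; apply: eq_bigr => j _; rewrite tmapE.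
rewrite {1}(IH A' B') // {1}vwE -big_split; apply: eq_bigr => i _.
by rewrite -big_split; apply: eq_bigr => j _; rewrite linearD.
Qed.

Lemma bicomponent_inj (R : realType) (V : gvoc R) (M : lmodType R[i])
    (J : choiceType) (H : grading J M) (x y : V ⊗ M) :
  (forall i j, bicomponent H x i j = bicomponent H y i j) -> x = y.
Proof.
move=> xy; apply/eqP; rewrite -subr_eq0; apply/eqP.
have [A [B ->]] := tens_component_sum (voc_gr V) H (x - y).
apply: big1 => i _; apply: big1 => j _.
by rewrite /bicomponent linearB /= -/(bicomponent _ _ _ _) xy subrr.
Qed.

(** * The coaction in degree 0 *)

Section Twisted.
Variables (R : realType) (V : gvoc R) (g : {linear V -> V}) (T : nat).
Hypothesis g_order : has_order g T.

(** On V_i the scalar series is z^(i - 1), so Res_z selects the coefficient of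
    z^(- i).  It does not depend on the eigenvalue of g, so the eigenprojections
    add up to the identity. *)
Lemma Delta_M0E (M : adm_comodule g T) (m : M) i n :
  Delta_M0 m i n = bicomponent (ac_gr M) (wc_Y (w := M) (- i%:~R) m) i n.
Proof.
have [T0 _ _] := g_order.
rewrite /Delta_M0 /residue.
transitivity (\sum_(r < T)
    tmap (eigenproj g T r) idfun
      (bicomponent (ac_gr M) (wc_Y (w := M) (- i%:~R) m) i n)).
  apply: eq_bigr => r _; rewrite (fsbigE [:: - i%:~R]) //=.
    rewrite big_mkcond big_seq1 in_setT /coact_weight opprK addrC eqxx.
    by rewrite rmorph1 scale1r.
  move=> q _; rewrite inE /coact_weight => qi.
  rewrite [X in ratr X](_ : _ = 0) ?rmorph0 ?scale0r //.
  by rewrite addrC (inj_eq (addIr _)) eqr_oppLR (negPf qi).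
move: (bicomponent _ _ _ _); apply: tensor_ind => [|v w x IH].
  by apply: big1 => r _; rewrite linear0.
under eq_bigr do rewrite linearD /= tmapE.
rewrite big_split /= IH; congr (_ + _).
rewrite -[in RHS](eigenproj_sum g T0 v).
by elim/big_rec2: _ => [|r y1 y2 _ ->]; rewrite ?tens0l ?tensDl.
Qed.

Lemma Delta_M0_natural (M1 M2 : adm_comodule g T) (psi : adm_hom M1 M2) m i n :
  tmap idfun psi (Delta_M0 m i n) = Delta_M0 (psi m) i n.
Proof.
rewrite !Delta_M0E -adm_Y /bicomponent !tmap_comp.
congr (tmap _ _ _); apply/funext => v; apply: component_morph => k.
exact: adm_gr.
Qed.

Definition restrict0 (M1 M2 : adm_comodule g T) (psi : adm_hom M1 M2)
    (m : subspace (ac_gr M1 0%N)) : subspace (ac_gr M2 0%N) :=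
  Subspace (adm_gr psi (subspace_valP m)).

Lemma restrict0_linear (M1 M2 : adm_comodule g T) (psi : adm_hom M1 M2) :
  linear (restrict0 psi).
Proof. by move=> a u v; apply: val_inj; rewrite /= !linearP. Qed.

HB.instance Definition _ (M1 M2 : adm_comodule g T) (psi : adm_hom M1 M2) :=
  GRing.isLinear.Build R[i] _ _ *:%R (restrict0 psi) (restrict0_linear psi).

Variable A : Cg_coalgebra g T.

(** After embedding both sides in V (x) M2 and taking components, this is
    Delta_M0_natural. *)
Lemma restrict0_coact (M1 M2 : adm_comodule g T) (S1 : M0_comodule A M1)
    (S2 : M0_comodule A M2) (psi : adm_hom M1 M2) (m : subspace (ac_gr M1 0%N)) :
  tmap idfun (restrict0 psi) (m0_coact S1 m) = m0_coact S2 (restrict0 psi m).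
Proof.
apply: tmap_val_inj; apply: (bicomponent_inj (H := ac_gr M2)) => i n.
rewrite (m0_coactE S2) /= -Delta_M0_natural -(m0_coactE S1).
rewrite /bicomponent !tmap_comp.
congr (tmap _ _ _); apply/funext => v.
by rewrite /= (component_morph (H := ac_gr M2)) //; exact: adm_gr.
Qed.

Definition Omega_mor (M1 M2 : adm_comodule g T) (S1 : M0_comodule A M1)
    (S2 : M0_comodule A M2) (psi : adm_hom M1 M2) :
    comodule_hom (Omega S1) (Omega S2) :=
  @ComoduleHom _ _ A (Omega S1) (Omega S2) (restrict0 psi)
    (restrict0_linear psi) (restrict0_coact S1 S2 psi).

End Twisted.

Theorem proposition5p3 (R : realType) (V : gvoc R) (g : {linear V -> V}) (T : nat)
    (g_aut : gvoc_aut g) (g_order : has_order g T)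
    (Cg_findim : findim (Cg g T)) :
  (forall (M1 M2 : adm_comodule g T) (psi : adm_hom M1 M2) (m : M1),
     m \in ac_gr M1 0%N ->
     psi m \in ac_gr M2 0%N /\
     forall i n, tmap idfun psi (Delta_M0 m i n) = Delta_M0 (psi m) i n) /\
  (forall A : Cg_coalgebra g T,
    (forall (M1 M2 : adm_comodule g T) (S1 : M0_comodule A M1)
        (S2 : M0_comodule A M2) (psi : adm_hom M1 M2),
       exists phi : comodule_hom (Omega S1) (Omega S2),
         forall m : subspace (ac_gr M1 0%N),
           subspace_val (phi m) = psi (subspace_val m)) /\
    (forall S : (forall M : adm_comodule g T, M0_comodule A M),
       exists Omega_hom : (forall M1 M2 : adm_comodule g T, adm_hom M1 M2 ->
                             comodule_hom (Omega (S M1)) (Omega (S M2))),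
         is_functor (A := adm_category g T) (B := comodule_category A)
           (fun M => Omega (S M)) Omega_hom /\
         forall (M1 M2 : adm_comodule g T) (psi : adm_hom M1 M2)
             (m : subspace (ac_gr M1 0%N)),
           subspace_val (Omega_hom M1 M2 psi m) = psi (subspace_val m))).
Proof.
split=> [M1 M2 psi m mM1|A].
  by split=> [|i n]; [exact: adm_gr|exact: Delta_M0_natural].
split=> [M1 M2 S1 S2 psi|S]; first by exists (Omega_mor g_order S1 S2 psi).
exists (fun M1 M2 psi => Omega_mor g_order (S M1) (S M2) psi); split=> //.
by split=> [M|M1 M2 M3 f h]; apply: comodule_hom_ext => m; apply: val_inj.
Qed.
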